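(* Let $\mathbb{T}=(T,\mu,\eta)$ be a 2-monad on $V\text{-}\mathbf{Cat}$. (1) The following assertions are equivalent: (i) $\mathbb{T}$ is lax idempotent; (ii) for each $V$-category $X$, the commutative square $\mu_X\cdot T\eta_X=\mu_X\cdot\eta_{TX}$, with top arrow $T\eta_X:TX\to TTX$, left arrow $\eta_{TX}:TX\to TTX$, right arrow $\mu_X:TTX\to TX$ and bottom arrow $\mu_X:TTX\to TX$, is a BC*-square. (2) If $\mathbb{T}$ is lax idempotent, then $\mu$ satisfies BC*.
   Context: $V$ is a commutative unital quantale: a complete lattice with a commutative, associative tensor $\otimes$, with unit $k\neq\bot$, preserving arbitrary joins in each variable. A $V$-category $(X,a)$ is a set $X$ with $a:X\times X\to V$ (also written $X(x,x')=a(x,x')$) such that $k\le a(x,x)$ and $a(x,x')\otimes a(x',x'')\le a(x,x'')$; a $V$-functor $f:(X,a)\to(Y,b)$ is a map with $a(x,x')\le b(f(x),f(x'))$. For $V$-functors $f,g:X\to Y$, $f\le g$ means $k\le Y(f(x),g(x))$ for all $x$; this (pre)order gives the 2-cells of the 2-category $V\text{-}\mathbf{Cat}$. Adjunction $f\dashv g$ means $1\le g\cdot f$ and $f\cdot g\le 1$. A 2-monad on $V\text{-}\mathbf{Cat}$ is a monad whose functor is monotone on hom-sets; it is lax idempotent if $T\eta_X\dashv\mu_X$ (equivalently $\mu_X\dashv\eta_{TX}$) for every $X$. A $V$-distributor $\varphi$ from $(X,a)$ to $(Y,b)$ is a map $\varphi:X\times Y\to V$ with $\varphi\cdot a\le\varphi$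 and $b\cdot\varphi\le\varphi$, where composition is $(s\cdot r)(x,z)=\bigvee_y r(x,y)\otimes s(y,z)$ and order is pointwise. A $V$-functor $f:X\to Y$ induces distributors $f_*$ from $X$ to $Y$, $f_*(x,y)=Y(f(x),y)$, and $f^*$ from $Y$ to $X$, $f^*(y,x)=Y(y,f(x))$. A commutative square of $V$-functors $h\cdot l=f\cdot g$, with $l:W\to Z$ (top), $g:W\to X$ (left), $h:Z\to Y$ (right), $f:X\to Y$ (bottom), is a BC*-square if $h^*\cdot f_*=l_*\cdot g^*$ (equivalently $h^*\cdot f_*\le l_*\cdot g^*$). A natural transformation $\alpha:S\to S'$ between endofunctors of $V\text{-}\mathbf{Cat}$ satisfies BC* if, for every $V$-functor $f:X\to Y$, the naturality square with top $\alpha_X$, left $Sf$, right $S'f$, bottom $\alpha_Y$ is a BC*-square. *)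

(* Defs.v *)
From HB Require Import structures.
From mathcomp Require Import all_boot all_order.
From mathcomp Require Import boolp classical_sets.

Set Implicit Arguments.
Unset Strict Implicit.
Unset Printing Implicit Defensive.

Import Order.TTheory.
Local Open Scope classical_set_scope.
Local Open Scope order_scope.

HB.mixin Record isCompleteLattice (d : Order.disp_t) V of Order.POrder d V := {
  bigsup : set V -> V;
  biginf : set V -> V;
  bigsupP : forall A : set V, supremums A (bigsup A);
  biginfP : forall A : set V, infimums A (biginf A)
}.

#[short(type="completeLatticeType")]
HB.structure Definition CompleteLattice (d : Order.disp_t) :=
  { V of Order.POrder d V & isCompleteLattice d V }.

(* The bottom element is the supremum of the empty set. *)
HB.mixin Record isQuantale (d : Order.disp_t) V of CompleteLattice d V := {
  tensor : V -> V -> V;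
  qunit : V;
  tensorA : associative tensor;
  tensorC : commutative tensor;
  tensor1v : left_id qunit tensor;
  tensor_bigsupr : forall (u : V) (A : set V),
    tensor u (bigsup A) = bigsup [set tensor u v | v in A];
  tensor_bigsupl : forall (A : set V) (u : V),
    tensor (bigsup A) u = bigsup [set tensor v u | v in A];
  qunit_neq_bot : qunit <> bigsup set0
}.

#[short(type="quantaleType")]
HB.structure Definition Quantale (d : Order.disp_t) :=
  { V of CompleteLattice d V & isQuantale d V }.

Notation "u ⊗ v" := (tensor u v) (at level 40, left associativity).

Section VCategories.
Context {d : Order.disp_t} {V : quantaleType d}.

Lemma bigsup_ub (A : set V) v : A v -> v <= bigsup A.
Proof. by move=> Av; have [ubA _] := bigsupP A; exact: ubA. Qed.

Lemma bigsup_le (A : set V) u : (forall v, A v -> v <= u) -> bigsup A <= u.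
Proof. by move=> Au; have [_ lbA] := bigsupP A; exact: lbA. Qed.

Lemma le_tensorl (u v w : V) : v <= w -> u ⊗ v <= u ⊗ w.
Proof.
move=> le_vw; have -> : w = bigsup [set v; w].
  apply/eqP; rewrite eq_le; apply/andP; split.
    by apply: bigsup_ub; right.
  by apply: bigsup_le => _ [->|->].
by rewrite tensor_bigsupr; apply: bigsup_ub; exists v => //; left.
Qed.

Record vcat := VCat {
  vobj :> Type;
  vhom : vobj -> vobj -> V;
  vhom_refl : forall x, qunit <= vhom x x;
  vhom_trans : forall x y z, vhom x y ⊗ vhom y z <= vhom x z
}.

(* By functional extensionality and proof irrelevance, Leibniz equality of
   V-functors is equality of the underlying maps; see vfun_ext. *)
Record vfun (X Y : vcat) := VFun {
  vapp :> X -> Y;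
  vapp_hom : forall x x', vhom x x' <= vhom (vapp x) (vapp x')
}.

Lemma vfun_ext (X Y : vcat) (f g : vfun X Y) : (forall x, f x = g x) -> f = g.
Proof.
case: f g => [f hf] [g hg] /= fg; have {}fg : f = g by apply/funext.
by subst g; congr VFun; exact: Prop_irrelevance.
Qed.

Definition vid (X : vcat) : vfun X X :=
  @VFun X X (fun x => x) (fun x x' => lexx _).

Lemma vcomp_subproof (X Y Z : vcat) (g : vfun Y Z) (f : vfun X Y) x x' :
  vhom x x' <= vhom (g (f x)) (g (f x')).
Proof. exact: le_trans (vapp_hom f x x') (vapp_hom g _ _). Qed.

Definition vcomp (X Y Z : vcat) (g : vfun Y Z) (f : vfun X Y) : vfun X Z :=
  VFun (vcomp_subproof g f).

Definition vfun_le (X Y : vcat) (f g : vfun X Y) : Prop :=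
  forall x, qunit <= vhom (f x) (g x).

Definition vadjoint (X Y : vcat) (f : vfun X Y) (g : vfun Y X) : Prop :=
  vfun_le (vid X) (vcomp g f) /\ vfun_le (vcomp f g) (vid Y).

Definition vrel_comp (X Y Z : Type) (s : Y -> Z -> V) (r : X -> Y -> V) :
    X -> Z -> V :=
  fun x z => bigsup [set r x y ⊗ s y z | y in [set: Y]].

Record vdist (X Y : vcat) := VDist {
  vdist_rel :> X -> Y -> V;
  vdist_src : forall x y, vrel_comp vdist_rel (@vhom X) x y <= vdist_rel x y;
  vdist_tgt : forall x y, vrel_comp (@vhom Y) vdist_rel x y <= vdist_rel x y
}.

Section Companions.
Variables (X Y : vcat) (f : vfun X Y).

Let lower_rel (x : X) (y : Y) := vhom (f x) y.
Let upper_rel (y : Y) (x : X) := vhom y (f x).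

Lemma lower_star_src x y : vrel_comp lower_rel (@vhom X) x y <= lower_rel x y.
Proof.
apply: bigsup_le => _ [x' _ <-]; apply: le_trans (vhom_trans _ (f x') _).
by rewrite tensorC [leRHS]tensorC; apply/le_tensorl/vapp_hom.
Qed.

Lemma lower_star_tgt x y : vrel_comp (@vhom Y) lower_rel x y <= lower_rel x y.
Proof. by apply: bigsup_le => _ [y' _ <-]; exact: vhom_trans. Qed.

Lemma upper_star_src y x : vrel_comp upper_rel (@vhom Y) y x <= upper_rel y x.
Proof. by apply: bigsup_le => _ [y' _ <-]; exact: vhom_trans. Qed.

Lemma upper_star_tgt y x : vrel_comp (@vhom X) upper_rel y x <= upper_rel y x.
Proof.
apply: bigsup_le => _ [x' _ <-]; apply: le_trans (vhom_trans _ (f x') _).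
by apply/le_tensorl/vapp_hom.
Qed.

Definition lower_star : vdist X Y := VDist lower_star_src lower_star_tgt.
Definition upper_star : vdist Y X := VDist upper_star_src upper_star_tgt.

End Companions.

(*        l
      W ----> Z
    g |       | h
      v       v
      X ----> Y
          f          *)
Definition bcstar_square (W X Y Z : vcat)
    (l : vfun W Z) (g : vfun W X) (h : vfun Z Y) (f : vfun X Y) : Prop :=
  vcomp h l = vcomp f g /\
  forall (x : X) (z : Z),
    vrel_comp (upper_star h) (lower_star f) x z =
    vrel_comp (lower_star l) (upper_star g) x z.

Record endofunctor := Endofunctor {
  fobj :> vcat -> vcat;
  fmap : forall X Y : vcat, vfun X Y -> vfun (fobj X) (fobj Y);
  fmap_id : forall X : vcat, fmap (vid X) = vid (fobj X);
  fmap_comp : forall (X Y Z : vcat) (g : vfun Y Z) (f : vfun X Y),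
    fmap (vcomp g f) = vcomp (fmap g) (fmap f)
}.

Definition idF : endofunctor :=
  @Endofunctor (fun X => X) (fun _ _ f => f) (fun _ => erefl)
    (fun _ _ _ _ _ => erefl).

Lemma compF_id (S T : endofunctor) (X : vcat) :
  fmap S (fmap T (vid X)) = vid (S (T X)).
Proof. by rewrite !fmap_id. Qed.

Lemma compF_comp (S T : endofunctor) (X Y Z : vcat)
    (g : vfun Y Z) (f : vfun X Y) :
  fmap S (fmap T (vcomp g f)) =
  vcomp (fmap S (fmap T g)) (fmap S (fmap T f)).
Proof. by rewrite !fmap_comp. Qed.

Definition compF (S T : endofunctor) : endofunctor :=
  @Endofunctor (fun X => S (T X)) (fun _ _ f => fmap S (fmap T f))
    (compF_id S T) (@compF_comp S T).

Record nattrans (S S' : endofunctor) := NatTrans {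
  component :> forall X : vcat, vfun (S X) (S' X);
  naturality : forall (X Y : vcat) (f : vfun X Y),
    vcomp (fmap S' f) (component X) = vcomp (component Y) (fmap S f)
}.

Definition nat_bcstar (S S' : endofunctor) (alpha : nattrans S S') : Prop :=
  forall (X Y : vcat) (f : vfun X Y),
    bcstar_square (alpha X) (fmap S f) (fmap S' f) (alpha Y).

Record two_monad := TwoMonad {
  mfunctor :> endofunctor;
  mmu : nattrans (compF mfunctor mfunctor) mfunctor;
  meta : nattrans idF mfunctor;
  mmu_assoc : forall X : vcat,
    vcomp (mmu X) (fmap mfunctor (mmu X)) =
    vcomp (mmu X) (mmu (mfunctor X));
  mmu_fmap_eta : forall X : vcat,
    vcomp (mmu X) (fmap mfunctor (meta X)) = vid (mfunctor X);
  mmu_eta : forall X : vcat,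
    vcomp (mmu X) (meta (mfunctor X)) = vid (mfunctor X);
  fmap_le : forall (X Y : vcat) (f g : vfun X Y),
    vfun_le f g -> vfun_le (fmap mfunctor f) (fmap mfunctor g)
}.

Definition lax_idempotent (T : two_monad) : Prop :=
  forall X : vcat, vadjoint (fmap T (meta T X)) (mmu T X).

End VCategories.

Arguments vcat {d} V.
Arguments endofunctor {d} V.
Arguments two_monad {d} V.

(* Main.v *)
(* By Yoneda, [h^* . f_*] at [(x, z)] is just [Y (f x) (h z)], so BC* asks that
   [Y (f x) (h z)] be bounded by a join over [W].  Under lax idempotency this
   bound is reached by a single element of [W], namely [mu x] in (1) and
   [eta z] in (2); conversely, every term of the join at [(x, x)] in (1) is
   below [TTX (T eta (mu x)) x], while the join itself is above the unit. *)
Require Import Defs.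
From mathcomp Require Import all_boot all_order.

Set Implicit Arguments.
Unset Strict Implicit.
Unset Printing Implicit Defensive.

Import Order.TTheory.
Local Open Scope order_scope.

Section QuantaleCategories.
Context {d : Order.disp_t} {V : quantaleType d}.
Implicit Types (W X Y Z : vcat V) (T : two_monad V).

Lemma le_tensor (u u' v v' : V) : u <= u' -> v <= v' -> u ⊗ v <= u' ⊗ v'.
Proof.
move=> le_uu' le_vv'; apply: le_trans (le_tensorl u le_vv') _.
by rewrite tensorC [leRHS]tensorC; exact: le_tensorl.
Qed.

Lemma vhom_le_trans X (x y z : X) (u v : V) :
  u <= vhom x y -> v <= vhom y z -> u ⊗ v <= vhom x z.
Proof.
by move=> le_u le_v; apply: le_trans (vhom_trans x y z); exact: le_tensor.
Qed.

Lemma vhom_unitl X (x y z : X) : qunit <= vhom x y -> vhom y z <= vhom x z.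
Proof.
by move=> le_xy; rewrite -[leLHS]tensor1v; exact: vhom_le_trans (lexx _).
Qed.

Lemma vhom_unitr X (x y z : X) : qunit <= vhom y z -> vhom x y <= vhom x z.
Proof.
move=> le_yz; rewrite -[leLHS]tensor1v tensorC.
exact: vhom_le_trans (lexx _) le_yz.
Qed.

Lemma vcomp_eqE W X Y Z
    (h : vfun Z Y) (l : vfun W Z) (f : vfun X Y) (g : vfun W X) :
  vcomp h l = vcomp f g -> forall w, h (l w) = f (g w).
Proof. by move=> hl_fg w; exact: (congr1 (fun u : vfun W Y => u w) hl_fg). Qed.

Lemma mmu_etaE T X w : mmu T X (meta T (T X) w) = w.
Proof. exact: (congr1 (fun u : vfun (T X) (T X) => u w) (mmu_eta T X)). Qed.

Lemma upper_lower_compE X Y Z (h : vfun Z Y) (f : vfun X Y) x z :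
  vrel_comp (upper_star h) (lower_star f) x z = vhom (f x) (h z).
Proof.
apply/le_anti/andP; split.
  by apply: bigsup_le => _ [y _ <-]; exact: vhom_trans.
rewrite -[leLHS]tensor1v.
apply: le_trans (le_tensor (vhom_refl (f x)) (lexx _)) _.
by apply: bigsup_ub; exists (f x).
Qed.

(** The other inequality is automatic: [g] and [l] meet after [f] and [h], so the images of the two
    factors of each term compose at [h (l w) = f (g w)]. *)
Lemma bcstar_squareP W X Y Z
    (l : vfun W Z) (g : vfun W X) (h : vfun Z Y) (f : vfun X Y) :
  bcstar_square l g h f <->
  vcomp h l = vcomp f g /\
  forall x z, vhom (f x) (h z) <= vrel_comp (lower_star l) (upper_star g) x z.
Proof.
split=> -[hl_fg bc]; split=> // x z; first by rewrite -bc upper_lower_compE.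
rewrite upper_lower_compE; apply/le_anti/andP; split; first exact: bc.
apply: bigsup_le => _ [w _ <-].
apply: (vhom_le_trans (y := h (l w))); last exact: vapp_hom.
by rewrite (vcomp_eqE hl_fg); exact: vapp_hom.
Qed.

Lemma lower_upper_comp_ub W X Z (l : vfun W Z) (g : vfun W X) w x z :
  vhom x (g w) ⊗ vhom (l w) z <= vrel_comp (lower_star l) (upper_star g) x z.
Proof. by apply: bigsup_ub; exists w. Qed.

(** The unit half of [T eta ⊣ mu] is the monad law [mu . T eta = 1]. *)
Lemma lax_idempotentP T :
  lax_idempotent T <->
  forall X, vfun_le (vcomp (fmap T (meta T X)) (mmu T X)) (vid (T (T X))).
Proof.
split=> [lax X|le_id X]; first by have [] := lax X.
by split; [rewrite mmu_fmap_eta => x; exact: vhom_refl | exact: le_id].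
Qed.

(* Restricting [T eta . mu <= 1] at [TX] along [eta] gives
   [T eta_TX <= eta_TTX]; composing with [T mu] turns this into
   [1 = T mu . T eta_TX <= T mu . eta_TTX = eta_TX . mu]. *)
Lemma lax_idempotent_le_eta_mu T X :
  lax_idempotent T ->
  vfun_le (vid (T (T X))) (vcomp (meta T (T X)) (mmu T X)).
Proof.
move=> /lax_idempotentP lax x.
have := lax (T X) (meta T (T (T X)) x).
rewrite /= mmu_etaE => le_eta.
have := le_trans le_eta (vapp_hom (fmap T (mmu T X)) _ _).
have /= -> := vcomp_eqE (naturality (meta T) (mmu T X)) x.
(* The identity is written as a composite to fit [vcomp_eqE]. *)
suff: vcomp (fmap T (mmu T X)) (fmap T (meta T (T X))) = vcomp (vid _) (vid _).
  by move/vcomp_eqE->.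
by rewrite -fmap_comp mmu_eta fmap_id; exact: vfun_ext.
Qed.

(** Each adjunction in [T eta ⊣ mu ⊣ eta] serves one factor: the unit of [mu ⊣ eta] puts the first
    above [qunit], and the counit of [T eta ⊣ mu] bounds [TX (mu x, mu z)] by the second. *)
Lemma lax_idempotent_bcstar T X :
  lax_idempotent T ->
  bcstar_square (fmap T (meta T X)) (meta T (T X)) (mmu T X) (mmu T X).
Proof.
move=> lax; apply/bcstar_squareP; split=> [|x z].
  by rewrite mmu_fmap_eta mmu_eta.
apply: le_trans (lower_upper_comp_ub _ _ (mmu T X x) _ _).
rewrite -[leLHS]tensor1v; apply: le_tensor.
  exact: (lax_idempotent_le_eta_mu lax x).
apply: le_trans (vapp_hom (fmap T (meta T X)) _ _) _; apply: vhom_unitr.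
by move/lax_idempotentP: lax => /(_ X z).
Qed.

Lemma bcstar_lax_idempotent T :
  (forall X,
     bcstar_square (fmap T (meta T X)) (meta T (T X)) (mmu T X) (mmu T X)) ->
  lax_idempotent T.
Proof.
move=> bc; apply/lax_idempotentP => X x.
have /bcstar_squareP[_ /(_ x x) le_join] := bc X.
apply: le_trans (vhom_refl _) (le_trans le_join _).
apply: bigsup_le => _ [w _ <-]; apply: vhom_le_trans (lexx _).
(* [mu] carries the first factor [TTX (x, eta w)] to [TX (mu x, w)], which [T eta] makes composable
   with the second. *)
apply: le_trans (vapp_hom (mmu T X) _ _) _.
by rewrite mmu_etaE; exact: vapp_hom.
Qed.

Lemma lax_idempotent_mu_bcstar T : lax_idempotent T -> nat_bcstar (mmu T).
Proof.
move=> lax X Y f; apply/bcstar_squareP; split=> [|y x].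
  exact: naturality.
apply: le_trans (lower_upper_comp_ub _ _ (meta T (T X) x) _ _).
rewrite mmu_etaE -[leLHS]tensor1v tensorC.
apply: le_tensor; last exact: vhom_refl.
(* Once [TTf (eta x)] is seen as [eta (Tf x)], applying [eta] to [TY (mu y, Tf x)] leaves only
   [y <= eta (mu y)]. *)
have /= -> := vcomp_eqE (naturality (meta T) (fmap T f)) x.
apply: le_trans (vapp_hom (meta T (T Y)) _ _) _; apply: vhom_unitl.
exact: (lax_idempotent_le_eta_mu lax y).
Qed.

End QuantaleCategories.

Theorem proposition3p5 (d : Order.disp_t) (V : quantaleType d)
    (T : two_monad V) :
  (lax_idempotent T <->
   forall X : vcat V,
     bcstar_square (fmap T (meta T X)) (meta T (T X)) (mmu T X) (mmu T X)) /\
  (lax_idempotent T -> nat_bcstar (mmu T)).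
Proof.
split; last exact: lax_idempotent_mu_bcstar.
split; last exact: bcstar_lax_idempotent.
by move=> lax X; exact: lax_idempotent_bcstar.
Qed.
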